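(* Let $G$ be a finite simple graph with vertices totally ordered as $v_1<v_2<\cdots<v_n$, and let $(E_1,\dots,E_n)$ be the ordered partition of $E(G)$ induced by this ordering. Then $$IF(G,t)=\prod_{i=1}^n(t-|E_i|).$$
   Context: The edge $v_iv_j$ with $i<j$ is labelled $(i,j)$, and $E_j=\{(i,j):(i,j)\in E(G)\}$ for $j=1,\dots,n$ (so $E_1=\emptyset$). A subtree of $G$ is increasing if the vertices along any path starting at its minimum vertex increase in the ordering. Let $f_k$ be the number of spanning forests of $G$ with $k$ edges all of whose components are increasing trees. The increasing spanning forest generating function is $IF(G,t)=\sum_{k=0}^{n-1}(-1)^k f_k t^{n-k}$. *)

(* Defs.v *)
From HB Require Import structures.
From mathcomp Require Import all_boot all_order all_algebra.

Set Implicit Arguments.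
Unset Strict Implicit.
Unset Printing Implicit Defensive.

Import Order.TTheory GRing.Theory Num.Theory.

Local Open Scope order_scope.

Section IncreasingForests.

Variables (d : Order.disp_t) (T : finOrderType d).
Implicit Types (e : rel T) (V : {set T}) (F : {set T * T}).

(* The undirected edge joining i and j, with i < j, is stored as the pair      *)
(* (i, j), so an edge set of a simple graph on T is a set of increasing pairs. *)
Definition edges e : {set T * T} := [set p | (p.1 < p.2) && e p.1 p.2].

Definition edges_to e (j : T) : {set T * T} := [set p in edges e | p.2 == j].

Definition adj F : rel T := fun x y => ((x, y) \in F) || ((y, x) \in F).

(* Duplicate-free sequences over T have size at most #|T|, so quantifying over *)
(* bounded sequences ranges over all simple cycles (resp. paths) while keeping *)
(* the predicates boolean; see acyclicP and increasingP.                       *)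
Definition acyclic F : bool :=
  [forall c : #|T|.-bseq T, (2 < size c)%N ==> ~~ ucycleb (adj F) c].

Definition is_tree V F : bool :=
  [&& V != set0,
      F \subset setX V V,
      [forall x in V, forall y in V, connect (adj F) x y]
    & acyclic F].

Definition is_min V (r : T) : bool := (r \in V) && [forall y in V, r <= y].

Definition increasing V F : bool :=
  [forall r : T, is_min V r ==>
    [forall p : #|T|.-bseq T,
      path (adj F) r p && uniq (r :: p) ==> path <%O r p]].

Definition increasing_tree V F : bool := is_tree V F && increasing V F.

Definition component F (x : T) : {set T} := [set y | connect (adj F) x y].

Definition component_edges F (x : T) : {set T * T} :=
  F :&: setX (component F x) (component F x).

Definition increasing_forest e F : bool :=
  [&& F \subset edges e, acyclic F
    & [forall x, increasing_tree (component F x) (component_edges F x)]].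

Definition nforests e (k : nat) : nat :=
  #|[set F : {set T * T} | increasing_forest e F & #|F| == k]|.

Definition IF_poly e : {poly int} :=
  (\sum_(k < #|T|) (-1) ^+ k * (nforests e k)%:R * 'X^(#|T| - k))%R.

Lemma uniq_leq_card (s : seq T) : uniq s -> (size s <= #|T|)%N.
Proof. by move/card_uniqP <-; apply: max_card. Qed.

Lemma acyclicP F :
  reflect (forall c : seq T, ucycle (adj F) c -> (size c <= 2)%N) (acyclic F).
Proof.
apply: (iffP forallP) => [H c cc | H c].
  have /uniq_leq_card sc : uniq c by case/andP: cc.
  by have := H (Bseq sc); rewrite [ucycleb _ _]cc implybF -leqNgt.
by apply/implyP => c2; apply/negP => /H; rewrite leqNgt c2.
Qed.

Lemma increasingP V F :
  reflect (forall (r : T) (p : seq T), is_min V r ->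
             path (adj F) r p -> uniq (r :: p) -> path <%O r p)
          (increasing V F).
Proof.
apply: (iffP forallP) => [H r p rV rp up | H r].
  have sp := ltnW (uniq_leq_card up).
  move/implyP: (H r) => /(_ rV) /forallP /(_ (Bseq sp)) /implyP; apply.
  exact/andP.
by apply/implyP => rV; apply/forallP => p; apply/implyP => /andP[]; apply: H.
Qed.

End IncreasingForests.

(* Main.v *)
Require Import Defs.
From HB Require Import structures.
From mathcomp Require Import all_boot all_order all_algebra.

(** A subgraph [F] is an increasing spanning forest exactly when every vertex
    [j] is the larger endpoint of at most one edge of [F]. Hence such a forest
    amounts to choosing, independently for each [j], either no edge or one of
    the edges in [E_j]. Weighting the first choice by ['X] and the others by
    [-1], expanding [\prod_j ('X - |E_j|)] sums [(-1)^|F| 'X^(n - |F|)] over all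
    increasing spanning forests. *)

Set Implicit Arguments.
Unset Strict Implicit.
Unset Printing Implicit Defensive.

Import Order.TTheory GRing.Theory Num.Theory.

Local Open Scope order_scope.

(** * Increasing forests as edge sets with at most one parent per vertex *)

Section ParentCharacterization.

Variables (d : Order.disp_t) (T : finOrderType d).
Implicit Types (e : rel T) (V : {set T}) (F : {set T * T}).

Definition increasing_edges F := forall x y, (x, y) \in F -> x < y.

Definition parent_unique F :=
  forall i k j, (i, j) \in F -> (k, j) \in F -> i = k.

Lemma adj_sym F : symmetric (adj F).
Proof. by move=> x y; rewrite /adj orbC. Qed.

Lemma adj_sub F F' : F \subset F' -> subrel (adj F) (adj F').
Proof.
by move=> /subsetP sF x y /orP[] /sF h; apply/orP; [left | right].
Qed.

Lemma acyclic_sub F F' : F \subset F' -> acyclic F' -> acyclic F.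
Proof.
move=> sF /acyclicP acF; apply/acyclicP => -[//|x c] /andP[cyc uc].
by apply: acF; apply/andP; split=> //; apply: sub_path cyc; apply: adj_sub.
Qed.

Lemma adj_lt F x y : increasing_edges F -> adj F x y -> x < y -> (x, y) \in F.
Proof.
by move=> incF /orP[//|/incF yx] xy; rewrite (lt_gtF xy) in yx.
Qed.

Lemma adj_component_edges F x y z :
  y \in component F x -> adj F y z -> adj (component_edges F x) y z.
Proof.
rewrite inE => xy yz; have xz := connect_trans xy (connect1 yz).
by rewrite /adj !inE /= xy xz !andbT.
Qed.

(** A path starting in the component of [x] never leaves it, so all its edges survive the
    restriction. *)
Lemma connect_component_edges F x y z :
  y \in component F x -> connect (adj F) y z ->
  connect (adj (component_edges F x)) y z.
Proof.
move=> xy /connectP[p]; elim: p y xy => [|w p IHp] y xy /=.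
  by move=> _ ->; apply: connect0.
case/andP=> yw wp lz; apply: connect_trans (IHp w _ wp lz).
  exact/connect1/adj_component_edges.
by move: xy; rewrite !inE => /connect_trans; apply; apply: connect1.
Qed.

Lemma path_lt_all (r : T) p :
  path <%O r p -> {in r :: p, forall y, y <= last r p}.
Proof.
elim: p r => [|x p IHp] r /=; first by move=> _ y; rewrite inE => /eqP->.
case/andP=> rx /IHp xp y; rewrite inE => /predU1P[->|/xp//].
by apply: (le_trans (ltW rx)); apply: xp; rewrite mem_head.
Qed.

(* Take increasing paths from the minimum [r] to the two parents [i] and [k].
   If [k] is not on the first, extend it by [j] and then [k]: the result is a
   simple path with a descent. So each parent lies on the path to the other. *)
Lemma increasing_forest_parent_unique e F :
  increasing_forest e F -> parent_unique F.
Proof.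
case/and3P=> /subsetP sF _ /forallP incF i k j ijF kjF.
have [/and4P[_ _ /forall_inP conn _] /increasingP inc] :=
  andP (incF j).
set V := component F j in conn inc; set C := component_edges F j in conn inc.
have jV : j \in V by rewrite inE connect0.
have [r rV rmin] : exists2 r, r \in V & forall y, y \in V -> r <= y.
  by case: (arg_minP id jV) => r rV rmin; exists r.
have isr : is_min V r by rewrite /is_min rV; apply/forall_inP.
have lift_par a : (a, j) \in F -> [/\ a \in V, a < j & adj C j a].
  move=> ajF; have aj : adj F j a by rewrite /adj ajF orbT.
  split; first by rewrite inE connect1.
    by have := sF _ ajF; rewrite inE => /andP[].
  exact: adj_component_edges.
have main a b : (a, j) \in F -> (b, j) \in F -> b <= a.
  move=> /lift_par[aV aj ja] /lift_par[bV bj jb].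
  have /connectP[p0 rp0] := forall_inP (conn r rV) a aV.
  case/shortenP: rp0 => p rp up _ la.
  have ltp := inc _ _ isr rp up.
  have [bp|bNp] := boolP (b \in r :: p).
    by rewrite la; apply: path_lt_all bp.
  have jNp : j \notin r :: p.
    by apply/negP => /(path_lt_all ltp); rewrite -la leNgt aj.
  have : path <%O r (p ++ [:: j; b]).
    apply: inc => //.
      by rewrite cat_path rp /= -la adj_sym ja jb.
    rewrite -cat_cons cat_uniq up /= orbF negb_or jNp bNp inE andbT /=.
    by rewrite (gt_eqF bj).
  by rewrite cat_path /= => /and4P[_ _ /lt_trans/(_ bj)]; rewrite ltxx.
by apply/le_anti; rewrite !main.
Qed.

(* Both neighbours of the largest vertex of a cycle would be its parents. *)
Lemma parent_unique_acyclic F :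
  increasing_edges F -> parent_unique F -> acyclic F.
Proof.
move=> incF uF; apply/acyclicP => c /andP[cyc uc].
rewrite leqNgt; apply/negP => sc.
have [x0 x0c] : exists x, x \in c.
  by case: c sc {cyc uc} => // x c; exists x; rewrite mem_head.
case: (arg_maxP id x0c) => m mc mmax.
(* Rotated to start at [m], the cycle has the neighbours of [m] as second and last entries; they
   differ because the length exceeds two. *)
have [n c' def_c] := rot_to mc.
have lt_m y : y \in c -> y != m -> y < m.
  by move=> yc ym; rewrite lt_neqAle ym; apply: mmax.
have memc y : (y \in c) = (y \in m :: c') by rewrite -def_c mem_rot.
move: cyc uc sc; rewrite -(rot_cycle n) -(rot_uniq n) -(size_rot n) def_c.
case: c' def_c memc => [|x c'] // _ memc.
case/lastP: c' memc => [|c' y] // memc.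
rewrite /= rcons_path last_rcons => /and3P[mx _ ym] /and3P[mN xN _] _.
move: mN xN; rewrite !inE !mem_rcons !inE !negb_or.
case/and3P=> mx' my' _ /andP[xy _].
have xF : (x, m) \in F.
  by apply: adj_lt; rewrite // 1?adj_sym //; apply: lt_m;
     rewrite 1?eq_sym // memc !inE eqxx orbT.
have yF : (y, m) \in F.
  by apply: adj_lt => //; apply: lt_m;
     rewrite 1?eq_sym // memc !inE mem_rcons mem_head !orbT.
by rewrite (uF _ _ _ xF yF) eqxx in xy.
Qed.

(* Once a simple path goes up it can never come down: a descent from [y] would
   lead back to its only parent. *)
Lemma parent_unique_path_up F (x y : T) p :
  increasing_edges F -> parent_unique F -> x < y ->
  path (adj F) x (y :: p) -> uniq (x :: y :: p) -> path <%O x (y :: p).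
Proof.
move=> incF uF; elim: p x y => [|z p IHp] x y xy; first by rewrite /= xy.
move=> /= /and3P[axy ayz zp] /andP[xN uyz]; rewrite xy /=.
apply: IHp => //=; last by rewrite ayz.
case/orP: ayz => [/incF//|zy].
move: xN; rewrite !inE (uF _ _ _ (adj_lt incF axy xy) zy).
by rewrite eqxx orbT.
Qed.

(** A path from the minimum must begin with an ascent, since [F] stays inside [V]; from then on it
    cannot descend. *)
Lemma parent_unique_increasing V F :
  increasing_edges F -> parent_unique F -> F \subset setX V V -> increasing V F.
Proof.
move=> incF uF /subsetP FV; apply/increasingP => r [//|y p].
case/andP=> _ /forall_inP rmin rp up; apply: (@parent_unique_path_up F) => //.
have /andP[ry _] := rp.
have yV : y \in V by case/orP: ry => /FV; rewrite inE => /andP[].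
rewrite lt_neqAle rmin // andbT.
by move: up; rewrite /= inE negb_or => /andP[/andP[]].
Qed.

(** This turns a global condition into one tested at each vertex. For the converse, acyclicity and
    parent uniqueness pass to subsets of [F], hence to the edges of each component. *)
Lemma increasing_forestP e F :
  reflect (F \subset edges e /\ parent_unique F) (increasing_forest e F).
Proof.
apply: (iffP idP) => [forF | [sF uF]].
  split; [by case/and3P: forF | exact: increasing_forest_parent_unique forF].
have incF : increasing_edges F.
  by move=> x y /(subsetP sF); rewrite inE => /andP[].
have acF := parent_unique_acyclic incF uF.
apply/and3P; split=> //; apply/forallP => x.
have sC : component_edges F x \subset F by apply: subsetIl.
apply/andP; split; last first.
  apply: parent_unique_increasing; last exact: subsetIr.
    by move=> y z /(subsetP sC); apply: incF.
  by move=> i k j /(subsetP sC) ij /(subsetP sC); apply: uF ij.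
apply/and4P; split; last exact: acyclic_sub acF.
- by apply/set0Pn; exists x; rewrite inE connect0.
- exact: subsetIr.
apply/forall_inP => y xy; apply/forall_inP => z xz.
apply: connect_component_edges => //.
move: xy xz; rewrite !inE (sym_connect_sym (adj_sym F)).
exact: connect_trans.
Qed.

(** Sending an edge to its larger endpoint is injective on [F] and misses the least vertex. The
    bound ensures that the range of [k] in [IF_poly] omits no forest. *)
Lemma card_increasing_forest e F :
  (0 < #|T|)%N -> increasing_forest e F -> (#|F| < #|T|)%N.
Proof.
move=> /card_gt0P[x0 _] /increasing_forestP[/subsetP sF uF].
case: (arg_minP id (erefl : predT x0)) => r _ rmin.
have injF : {in F &, injective snd}.
  move=> [i j] [k l] /= iF kF jl; rewrite -jl in kF *.
  by rewrite (uF _ _ _ iF kF).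
rewrite -(card_in_imset injF) -cardsT; apply: proper_card.
rewrite properT; apply/eqP => /setP/(_ r); rewrite inE.
case/imsetP=> -[i j] /sF; rewrite inE /= => /andP[ij _] rj.
by have := rmin i isT; rewrite /= rj leNgt ij.
Qed.

End ParentCharacterization.

(** * The bijection between increasing forests and parent maps *)

Section ForestsAsParentMaps.

Variables (d : Order.disp_t) (T : finOrderType d) (e : rel T).
Implicit Types (F : {set T * T}) (f : {ffun T -> option T}).

(** The choice made by [pick] is canonical only under [parent_unique F]; [None] marks the roots. *)
Definition parent_map F : {ffun T -> option T} :=
  [ffun j => [pick i | (i, j) \in F]].

Definition parent_graph f : {set T * T} := [set p | f p.2 == Some p.1].

Definition parent_choices (j : T) : pred (option T) :=
  fun o => if o is Some i then (i, j) \in edges e else true.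

Lemma parent_mapK F : parent_unique F -> parent_graph (parent_map F) = F.
Proof.
move=> uF; apply/setP => -[i j]; rewrite inE ffunE /=.
case: pickP => [k kF | noF]; last by rewrite noF.
by apply/eqP/idP => [[<-]//|iF]; rewrite (uF _ _ _ iF kF).
Qed.

Lemma parent_graphK f : parent_map (parent_graph f) = f.
Proof.
apply/ffunP => j; rewrite ffunE.
case: pickP => [k | noF]; first by rewrite inE => /eqP.
by case Ef: (f j) => [i|//]; have := noF i; rewrite inE /= Ef eqxx.
Qed.

Lemma parent_graph_unique f : parent_unique (parent_graph f).
Proof. by move=> i k j; rewrite !inE /= => /eqP-> /eqP[]. Qed.

(** A map assigns at most one parent to each vertex, so only membership of the chosen edges in the
    graph remains to be tested, independently at each vertex. *)
Lemma increasing_forest_parent_graph f :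
  increasing_forest e (parent_graph f) = (f \in family parent_choices).
Proof.
apply/increasing_forestP/familyP => [[/subsetP sF _] j | fam].
  rewrite unfold_in; case Ef: (f j) => [i|//]; apply: sF.
  by rewrite inE /= Ef.
split; last exact: parent_graph_unique.
apply/subsetP => -[i j]; rewrite inE /= => /eqP Ef.
by have := fam j; rewrite unfold_in Ef.
Qed.

Lemma card_parent_graph f : #|parent_graph f| = #|[pred j | f j != None]|.
Proof.
have inj : {in parent_graph f &, injective snd}.
  move=> [i j] [k l] iF kF /= jl; rewrite -jl in kF *.
  by rewrite (parent_graph_unique iF kF).
rewrite -(card_in_imset inj) -[RHS]cardsE; apply: eq_card => j; rewrite !inE.
apply/imsetP/idP => [[[i k]] | ].
  by rewrite inE /= => /eqP Ef ->; rewrite Ef.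
by case Ef: (f j) => [i|//] _; exists (i, j); rewrite // inE /= Ef.
Qed.

(** * Weights of choices and the generating function *)

Local Open Scope ring_scope.

Definition choice_weight (o : option T) : {poly int} :=
  if o is None then 'X else -1.

Lemma sum_choice_weight j :
  \sum_(o in parent_choices j) choice_weight o
    = 'X - (#|edges_to e j|%:R)%:P.
Proof.
rewrite (bigD1 None) //=; congr (_ + _).
rewrite (reindex_omap Some id) /=; last by case.
rewrite (eq_bigl [in [set i | (i, j) \in edges e]]); last first.
  by move=> i; rewrite !inE unfold_in eqxx andbT [in LHS]inE andbT.
rewrite (eq_bigr (fun=> -1)) // sumr_const mulNrn; congr (- _).
rewrite polyC_natr; congr (_%:R).
have inj : injective (fun i : T => (i, j)) by move=> i k [].
rewrite -(card_imset _ inj); apply: eq_card => -[i k]; rewrite [in RHS]inE /=.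
apply/imsetP/andP => [[i' + [-> ->]]|[ik /eqP kj]]; first by rewrite inE eqxx.
by exists i; rewrite -kj // inE.
Qed.

(** Each edge is counted at its larger endpoint with weight [-1]; the remaining vertices are roots
    and contribute ['X] each. *)
Lemma prod_choice_weight f :
  \prod_j choice_weight (f j)
    = (-1) ^+ #|parent_graph f| * 'X^(#|T| - #|parent_graph f|).
Proof.
rewrite (bigID [pred j | f j != None]) /= card_parent_graph; congr (_ * _).
  by rewrite (eq_bigr (fun=> -1)) ?prodr_const // => j; case: (f j).
rewrite (eq_bigr (fun=> 'X)); last by move=> j; rewrite negbK => /eqP->.
rewrite prodr_const; congr (_ ^+ _).
by rewrite -(cardC [pred j | f j != None]) addKn; apply: eq_card.
Qed.

Lemma IF_polyE : (0 < #|T|)%N ->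
  IF_poly e = \sum_(F | increasing_forest e F) (-1) ^+ #|F| * 'X^(#|T| - #|F|).
Proof.
move=> T_gt0.
(* Each term becomes a one-term sum over [k = #|F|]; exchanging the sums then groups forests by
   number of edges. *)
rewrite [RHS](eq_bigr (fun F : {set T * T} =>
  \sum_(k < #|T| | #|F| == k) (-1) ^+ k * 'X^(#|T| - k)))
  => [|F forF]; last first.
  by rewrite (big_pred1 (Ordinal (card_increasing_forest T_gt0 forF))).
rewrite (exchange_big_dep predT) //=; apply: eq_bigr => k _.
rewrite sumr_const -[RHS]mulr_natr [RHS]mulrAC; congr (_ * _%:R * _).
by rewrite /nforests cardsE.
Qed.

End ForestsAsParentMaps.

Local Open Scope ring_scope.

Theorem theorem6p3 (d : Order.disp_t) (T : finOrderType d) (e : rel T)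
    (e_sym : symmetric e) (e_irr : irreflexive e) (T_nonempty : (0 < #|T|)%N) :
  IF_poly e = \prod_(j : T) ('X - (#|edges_to e j|%:R)%:P).
Proof.
under eq_bigr do rewrite -sum_choice_weight.
(* The expanded product runs over parent maps, so the forest sum is reindexed by them; [parent_map]
   is the inverse on increasing forests. *)
rewrite bigA_distr_big_dep IF_polyE // (reindex (@parent_graph d T)) /=.
  apply: eq_big => [f|f _]; first exact: increasing_forest_parent_graph.
  by rewrite prod_choice_weight.
exists (@parent_map d T) => [f _|F]; first exact: parent_graphK.
by rewrite inE => /increasing_forestP[_ /parent_mapK].
Qed.
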